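(* $\mathfrak{b}(\mathcal{S},\mathcal{S},\mathcal{S})=\aleph_1$.
   Context: Let $\Omega$ be the (countable) set of all clopen subsets of the Cantor space $2^\omega$ having Lebesgue measure $1/2$. Solecki's ideal $\mathcal{S}$ on $\Omega$ is the ideal generated by the sets $G_x=\{A\in\Omega:x\in A\}$, $x\in 2^\omega$, i.e. $\mathcal{S}=\{C\subseteq\Omega:\exists x_1,\dots,x_n\ (C\setminus(G_{x_1}\cup\dots\cup G_{x_n})\text{ finite})\}$. For an ideal $\mathcal{K}$ on a countable set $X$ (closed under finite unions and subsets, contains all finite sets, $X\notin\mathcal{K}$), $\widehat{\mathcal{P}}_{\mathcal{K}}$ is the family of sequences $\langle A_n:n\in\omega\rangle$ of pairwise disjoint members of $\mathcal{K}$, and $\mathcal{P}_{\mathcal{K}}$ those with union $X$. For ideals $\mathcal{I},\mathcal{J},\mathcal{K}$ on $X$, $\mathfrak{b}(\mathcal{I},\mathcal{J},\mathcal{K})=\min\{|\mathcal{E}|:\mathcal{E}\subseteq\widehat{\mathcal{P}}_{\mathcal{K}},\ \forall\langle A_n\rangle\in\mathcal{P}_{\mathcal{J}}\ \exists\langle E_n\rangle\in\mathcal{E}\ \bigcup_n(A_n\cap\bigcup_{i\le n}E_i)\notin\mathcal{I}\}$, with $\min\emptyset=\mathfrak{c}^+$. *)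

(* Defs.v *)
From HB Require Import structures.
From mathcomp Require Export all_boot all_order all_algebra.
From mathcomp Require Export all_classical all_reals.
From mathcomp Require Export ereal topology sequences cantor.

Set Implicit Arguments.
Unset Strict Implicit.
Unset Printing Implicit Defensive.

Import Order.TTheory GRing.Theory Num.Theory.

Local Open Scope classical_set_scope.
Local Open Scope ring_scope.
Local Open Scope card_scope.

Definition cylinder (s : seq bool) : set cantor_space :=
  [set x | forall i, (i < size s)%N -> x i = nth false s i].

(* Lebesgue (fair-coin) outer measure on the Cantor space, generated by
   giving the cylinder over s the mass 2^-|s|.  It is defined on all sets, and
   on measurable sets (in particular clopen ones) it is Lebesgue measure. *)
Definition cantor_lebesgue (R : realType) (A : set cantor_space) : \bar R :=
  ereal_inf [set (\sum_(0 <= k <oo) ((2 ^- size (s k))%:E : \bar R))%E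
            | s in [set s : nat -> seq bool | A `<=` \bigcup_k cylinder (s k)]].

Definition Omega (R : realType) : Type :=
  {A : set cantor_space | clopen A /\ cantor_lebesgue R A = (2^-1)%:E}.

Definition solecki_gen (R : realType) (x : cantor_space) : set (Omega R) :=
  [set A | sval A x].
Arguments solecki_gen : clear implicits.

Definition solecki (R : realType) : set (set (Omega R)) :=
  [set C | exists2 F : set cantor_space, finite_set F &
           finite_set (C `\` \bigcup_(x in F) solecki_gen R x)].
Arguments solecki : clear implicits.

Section BInvariant.
Variable X : Type.
Implicit Types I J K : set (set X).

Definition Phat K : set (nat -> set X) :=
  [set A | trivIset setT A /\ forall n, K (A n)].

Definition Ppart K : set (nat -> set X) :=
  [set A | Phat K A /\ \bigcup_n A n = setT].

Definition b_witness I J K : set (set (nat -> set X)) :=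
  [set E | E `<=` Phat K /\
    forall A, Ppart J A -> exists2 e, E e &
      ~ I (\bigcup_n (A n `&` \bigcup_(i in [set i | (i <= n)%N]) e i))].

End BInvariant.

(* |B| is the cardinal successor of |A|. *)
Definition card_succ (T U : Type) (A : set T) (B : set U) : Prop :=
  [/\ A #<= B, ~ (B #<= A) &
      forall (V : Type) (C : set V), A #<= C -> ~ (C #<= A) -> B #<= C].

Definition is_aleph1 (U : Type) (kappa : set U) : Prop :=
  card_succ [set: nat] kappa.

(* Cardinals are represented by sets up to equinumerosity: this says that
   b(I, J, K) = |kappa|, with the convention min(emptyset) = c^+.  The formula
   makes sense for arbitrary families, but is meant for ideals on X. *)
Definition is_b (X : Type) (I J K : set (set X)) (U : Type) (kappa : set U) :
    Prop :=
  (exists2 E, b_witness I J K E &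
     E #= kappa /\ forall E', b_witness I J K E' -> E #<= E')
  \/ (b_witness I J K = set0 /\ card_succ [set: set nat] kappa).

(* Main.v *)
Require Import Defs.
From mathcomp Require Import wochoice.
From mathcomp Require Import lra.

(** Lower bound: let [e^k] be countably many sequences in S, and let [G_{d_j}]
    cover Omega, with [d_j] dense.  Let [B_m] be the union of the [e^k_i] with
    [k, i <= m + 1] and of the [G_{d_j}] with [j <= m], and let [A] be the
    disjointification of [B].  A point of [A_n] in [e^k_i] with [i <= n] must
    have [i <= k], so the set attached to [A] and [e^k] is contained in the
    union of the [e^k_i] for [i <= k] and belongs to S.

    Upper bound: take aleph_1 pairwise disjoint injective sequences [x^a] of
    points and disjointify [n |-> G_{x^a_n}].  If [A_n] is almost covered by
    the [G_y] with [y] in a finite set [F_n], some [x^a] avoids the countable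
    set of all these [y].  If the set attached to [A] and [x^a] were almost
    covered by the [G_z] with [z] in a finite set [Z], choose [x^a_k] outside
    [Z]: infinitely many members of Omega contain [x^a_k] and miss
    [Z], [F_0], ..., [F_k]; almost all of them lie in some [A_n] with [n > k],
    hence in the attached set, a contradiction. *)

Set Implicit Arguments.
Unset Strict Implicit.
Unset Printing Implicit Defensive.

Import Order.TTheory GRing.Theory Num.Theory.

Local Open Scope classical_set_scope.
Local Open Scope ring_scope.
Local Open Scope card_scope.

(** * Well-orders and sets of cardinality aleph_1 *)

Section Aleph1.
Variables (T : eqType) (le : rel T).
Hypothesis wo_le : well_order le.

Let lt x y := le x y && (x != y).

Lemma well_order_antisym x y : le x y -> le y x -> x = y.
Proof.
move=> xy yx; have le_chain : wo_chain le predT by move=> A _; exact: wo_le.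
by apply: (wo_chain_antisymmetric le_chain) => //; rewrite xy yx.
Qed.

Lemma well_order_lt_total x y : x <> y -> lt x y \/ lt y x.
Proof.
move=> xy; have le_chain : wo_chain le predT by move=> A _; exact: wo_le.
have /orP[xley|ylex] := @wo_chainW _ _ _ le_chain x y isT isT.
- by left; rewrite /lt xley; apply/eqP.
- by right; rewrite /lt ylex; apply/eqP => /esym.
Qed.

Lemma well_order_minimum (P : T -> Prop) :
  (exists x, P x) -> exists2 z, P z & forall y, lt y z -> ~ P y.
Proof.
move=> [a Pa]; pose A : {pred T} := fun z => `[< P z >].
have [|z [[/asboolP Pz zmin] _]] := wo_le (A := A).
  by exists a; apply/asboolP.
exists z => // y /andP[yz /eqP yNz] Py.
by apply: yNz; apply: well_order_antisym => //; apply: zmin; apply/asboolP.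
Qed.

Lemma well_order_wf : well_founded (fun x y => lt x y : Prop).
Proof.
move=> a; apply: contrapT => aN.
have [|z zN zmin] := @well_order_minimum (fun z => ~ Acc (fun x y => lt x y) z).
  by exists a.
by apply: zN; split => y /zmin /contrapT.
Qed.

(* A greedy transfinite recursion: at stage [x] only countably many points of
   [C] have been used. *)
Lemma countable_segments_card_le (kappa : set T) V (C : set V) :
  (forall x, kappa x -> countable [set y | lt y x]) -> ~ countable C ->
  kappa #<= C.
Proof.
move=> segc Cunc.
have [v0 _] : C !=set0.
  by apply/set0P/negP => /eqP C0; apply: Cunc; rewrite C0; exact: countable0.
pose next x (g : forall y, lt y x -> V) v :=
  C v /\ forall y (yx : lt y x), g y yx <> v.
pose F x (g : forall y, lt y x -> V) : V :=
  if pselect (exists v, next x g v) is left h then projT1 (cid h) else v0.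
pose f := Fix well_order_wf (fun=> V) F.
have fE x : f x = F x (fun y _ => f y).
  apply: (Fix_eq well_order_wf (fun=> V) F) => z g h gh; congr F.
  by apply: functional_extensionality_dep => y;
    apply: functional_extensionality_dep => yz; exact: gh.
have fP x : kappa x -> next x (fun y _ => f y) (f x).
  move=> kx; rewrite [f x]fE /F; case: pselect => [h|]; first by case: cid.
  (* With no admissible value left, [C] would lie in the image under [f] of the countable segment
     below [x]. *)
  move=> nonext; exfalso; apply: Cunc.
  apply: sub_countable (sub_countable (card_image_le f _) (segc x kx)).
  apply: subset_card_le => v Cv; apply: contrapT => vN; apply: nonext.
  by exists v; split=> // y yx fyv; apply: vN; exists y.
have finj : set_inj kappa f.
  move=> x y /set_mem kx /set_mem ky fxy.
  have [//|/well_order_lt_total [xy|yx]] := pselect (x = y).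
  - by have [_ /(_ x xy)] := fP _ ky; rewrite fxy.
  - by have [_ /(_ y yx)] := fP _ kx; rewrite fxy.
have fC : set_fun kappa C f by move=> x /fP [].
have [g] : $|{injfun kappa >-> C}| by apply/injfunPex; exists f.
exact: inj_card_le g.
Qed.

End Aleph1.

(** An uncountable set is infinite, so it already dominates [[set: nat]]. *)
Lemma is_aleph1P U (kappa : set U) : is_aleph1 kappa <->
  ~ countable kappa /\
  forall V (C : set V), ~ countable C -> kappa #<= C.
Proof.
split=> [[nk kn kmin]|[kunc kmin]].
  split=> // V C Cunc; apply: kmin => //.
  by apply/infiniteP => /finite_set_countable.
split=> //; first by apply/infiniteP => /finite_set_countable.
by move=> V C _; exact: kmin.
Qed.

(** If some initial segment is uncountable, the least such segment works; otherwise the whole type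
    does. In both cases the segments below its points are countable, so the greedy recursion
    applies. *)
Lemma exists_aleph1_subset (T : eqType) :
  ~ countable [set: T] -> exists kappa : set T, is_aleph1 kappa.
Proof.
move=> Tunc; have [le wo_le] := well_ordering_principle T.
pose seg x := [set y | le y x && (y != x)].
have [[x xunc]|segc] := pselect (exists x, ~ countable (seg x)).
  have [|z zunc zmin] :=
      well_order_minimum wo_le (P := fun x => ~ countable (seg x)).
    by exists x.
  exists (seg z); apply/is_aleph1P; split=> // V C.
  apply: (countable_segments_card_le wo_le) => y yz.
  exact: contrapT (zmin y yz).
exists [set: T]; apply/is_aleph1P; split=> // V C.
apply: (countable_segments_card_le wo_le) => y _.
by apply: contrapT => yunc; apply: segc; exists y.
Qed.

(** * The Cantor space: uncountability, clopen sets, compactness *)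

Lemma cantor_space_uncountable : ~ countable [set: cantor_space].
Proof.
move=> /countable_injP [f finj].
(* As [f] is injective, [d] differs from every [x] at coordinate [f x], hence from itself. *)
pose d : cantor_space := fun n => ~~ `[< exists2 x : cantor_space, f x = n & x n >].
have dE : d (f d) = ~~ d (f d).
  rewrite {1}/d; congr (~~ _); apply/asboolP/idP => [[x /finj]|dd].
    by rewrite !in_setT => /(_ isT isT) ->.
  by exists d.
by case: (d (f d)) dE.
Qed.

Definition agree n (x y : cantor_space) := forall i, (i < n)%N -> x i = y i.

Lemma agreeW m n x y : (m <= n)%N -> agree n x y -> agree m x y.
Proof. by move=> mn xy i im; apply: xy; exact: leq_trans mn. Qed.

Lemma open_coord i b : open [set y : cantor_space | y i = b].
Proof.
have cont : continuous (fun y : cantor_space => y i : bool).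
  exact: (@proj_continuous nat (fun=> bool : topologicalType) i).
move/continuousP: cont => cont.
exact: (cont [set b] (discrete_open _)).
Qed.

Lemma open_agree n x : open [set y | agree n x y].
Proof.
elim: n => [|n ih].
  have -> : [set y | agree 0 x y] = setT by apply/seteqP; split.
  exact: openT.
have -> : [set y | agree n.+1 x y] =
    [set y | agree n x y] `&` [set y | y n = x n].
  apply/seteqP; split => y /= => [xy|[xy yn] i].
    by split; [exact: agreeW xy|rewrite xy].
  by rewrite ltnS leq_eqVlt => /predU1P[->//|/xy].
exact: openI (open_coord _ _).
Qed.

Lemma open_finitely_determined n (A : set cantor_space) :
  (forall x y, agree n x y -> A x -> A y) -> open A.
Proof.
move=> An; have -> : A = \bigcup_(x in A) [set y | agree n x y].
  by apply/seteqP; split => [x Ax|y [x Ax /= /An]]; [exists x|exact].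
by apply: bigcup_open => x _; exact: open_agree.
Qed.

Lemma clopen_finitely_determined n (A : set cantor_space) :
  (forall x y, agree n x y -> A x -> A y) -> clopen A.
Proof.
move=> An; split; first exact: open_finitely_determined An.
rewrite -openC; apply: (@open_finitely_determined n) => x y xy Ax Ay.
by apply: Ax; apply: An Ay => i /xy.
Qed.

Lemma open_cylinder s : open (cylinder s).
Proof.
apply: (@open_finitely_determined (size s)) => x y xy xs i si.
by rewrite -xy ?xs.
Qed.

Lemma compact_cantor_countable_cover (A : set cantor_space)
    (U : nat -> set cantor_space) :
  closed A -> (forall i, open (U i)) -> A `<=` \bigcup_i U i ->
  exists n, A `<=` \bigcup_(i < n) U i.
Proof.
move=> cA oU AU.
have : compact A by apply: subclosed_compact cantor_space_compact _.
rewrite compact_cover => /(_ nat setT U (fun i _ => oU i) AU) [D _ AD].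
exists (\max_(i <- finmap.enum_fset D) i).+1 => x /AD [i iD Uix].
exists i => //=; rewrite ltnS; exact: leq_bigmax_seq.
Qed.

(** The open sets of points differing from [x] at coordinate [i] cover the complement of [B]; by
    compactness finitely many suffice. *)
Lemma open_agree_sub (B : set cantor_space) x :
  open B -> B x -> exists n, forall y, agree n x y -> B y.
Proof.
move=> oB Bx.
have [|i||n BN] := @compact_cantor_countable_cover (~` B)
  (fun i => [set y | y i = ~~ x i]).
- by rewrite closedC.
- exact: open_coord.
- move=> y By; apply: contrapT => xy; apply: By.
  suff <- : x = y by [].
  apply/funext => i; apply: contrapT => xyi; apply: xy; exists i => //=.
  by case: (x i) (y i) xyi => [] [].
exists n => y xy; apply: contrapT => /BN [i /= /xy -> ].
by case: (y i).
Qed.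

(** * Measure of the sets that prescribe one bit from the earlier ones *)

Section Mass.
Variable R : realType.
Implicit Types (A B : set cantor_space) (s : seq bool).

Definition ccons (b : bool) (x : cantor_space) : cantor_space :=
  fun i => if i is j.+1 then x j else b.

Lemma cconsK (x : cantor_space) : ccons (x 0%N) (fun i => x i.+1) = x.
Proof. by apply/funext => -[]. Qed.

(* The proportion of words of length [n] that, extended by zeros, lie in [A]. *)
Fixpoint mass n A : R :=
  if n is m.+1 then
    (mass m (ccons false @^-1` A) + mass m (ccons true @^-1` A)) / 2
  else (`[< A (fun=> false) >])%:R.

Lemma mass_le n A B : A `<=` B -> mass n A <= mass n B.
Proof.
elim: n A B => [|n ih] A B AB /=.
  rewrite ler_nat; case: (asboolP (A _)) => // /AB ?.
  by case: asboolP.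
have h b : mass n (ccons b @^-1` A) <= mass n (ccons b @^-1` B).
  by apply: ih => x; exact: AB.
have := h true; have := h false; lra.
Qed.

Lemma massU n A B : mass n (A `|` B) <= mass n A + mass n B.
Proof.
elim: n A B => [|n ih] A B /=.
  rewrite -natrD ler_nat; case: (asboolP ((A `|` B) _)) => // -[] ?.
    by case: (asboolP (A _)).
  by case: (asboolP (B _)) => //; rewrite addn1.
rewrite !preimage_setU.
have := ih (ccons true @^-1` A) (ccons true @^-1` B).
have := ih (ccons false @^-1` A) (ccons false @^-1` B).
lra.
Qed.

Lemma mass0 n : mass n set0 = 0.
Proof.
elim: n => [|n /= ih]; last by rewrite !preimage_set0 ih addr0 mul0r.
by rewrite /=; case: asboolP.
Qed.

Lemma massT n : mass n setT = 1.
Proof.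
elim: n => [|n /= ih]; last by rewrite !preimage_setT ih; lra.
by rewrite /=; case: asboolP.
Qed.

Lemma cylinder_nil : cylinder [::] = setT.
Proof. by apply/seteqP; split. Qed.

Lemma ccons_cylinder b c s :
  ccons b @^-1` cylinder (c :: s) = if b == c then cylinder s else set0.
Proof.
apply/seteqP; split => x.
  move=> xs; have /= <- := xs 0%N isT; rewrite eqxx => i si.
  exact: (xs i.+1).
by case: eqP => // <- xs [|i] //=; rewrite ltnS => /xs.
Qed.

Lemma mass_cylinder n s :
  (size s <= n)%N -> mass n (cylinder s) = 2 ^- size s.
Proof.
elim: s n => [n _|c s ih [//|n]]; first by rewrite cylinder_nil massT expr0 invr1.
rewrite /= ltnS => /ih sn; rewrite !ccons_cylinder exprS invfM.
by case: c; rewrite /= mass0 sn; lra.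
Qed.

(** Subadditivity splits off one cylinder at a time; level [n] is deep enough for each to have its
    exact mass. *)
Lemma mass_le_cylinders n A (l : seq (seq bool)) :
  (forall s, s \in l -> (size s <= n)%N) ->
  (forall x, A x -> exists2 s, s \in l & cylinder s x) ->
  mass n A <= \sum_(s <- l) 2 ^- size s.
Proof.
elim: l A => [|s l ih] A ln Al.
  rewrite big_nil -(mass0 n); apply: mass_le => x /Al [].
  by [].
rewrite big_cons -(@mass_cylinder n) ?ln ?mem_head //.
apply: (@le_trans _ _ (mass n (cylinder s `|` (A `\` cylinder s)))).
  by apply: mass_le => x Ax; have [?|?] := pselect (cylinder s x); [left|right].
apply: le_trans (massU _ _ _) _; rewrite lerD2l; apply: ih => [t tl|x [Ax xs]].
  by apply: ln; rewrite inE tl orbT.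
have [t] := Al x Ax; rewrite inE => /predU1P[-> //|tl xt].
by exists t.
Qed.

Lemma agree_ccons n b x y : agree n x y -> agree n.+1 (ccons b x) (ccons b y).
Proof. by move=> xy [|i] //= /xy. Qed.

(** When [f] depends only on the first [n] bits, this is clopen of measure 1/2; all members of
    [Omega] built below have this form. *)
Definition half_space n (f : cantor_space -> bool) : set cantor_space :=
  [set y | y n = f y].

Lemma mass_half_space n m (f : cantor_space -> bool) :
  (forall x y, agree n x y -> f x = f y) -> (n < m)%N ->
  mass m (half_space n f) = 2^-1.
Proof.
elim: n m f => [|n ih] [|m] //= f fn nm; last first.
  have h b : mass m (ccons b @^-1` half_space n.+1 f) = 2^-1.
    apply: (ih m (f \o ccons b)) => // x y xy /=.
    by apply: fn; exact: agree_ccons.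
  by rewrite !h; lra.
have h b : ccons b @^-1` half_space 0 f =
    if b == f (fun=> false) then setT else set0.
  apply/seteqP; split => x; rewrite /half_space /= (fn _ (fun=> false)) //.
    by move=> ->; rewrite eqxx.
  by case: eqP.
by rewrite !h; case: (f _); rewrite /= massT mass0; lra.
Qed.

Lemma half_space_cover n (f : cantor_space -> bool) :
  (forall x y, agree n x y -> f x = f y) ->
  exists2 l : seq (seq bool),
    (forall x, half_space n f x -> exists2 s, s \in l & cylinder s x) &
    \sum_(s <- l) 2 ^- size s = 2^-1 :> R.
Proof.
elim: n f => [|n ih] f fn.
  exists [:: [:: f (fun=> false)]]; last by rewrite big_seq1 /= expr1.
  move=> x xf; exists [:: f (fun=> false)]; first by rewrite mem_seq1.
  by case=> //= _; rewrite xf; apply: fn.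
have h b : exists2 l : seq (seq bool),
    (forall x, half_space n (f \o ccons b) x -> exists2 s, s \in l & cylinder s x) &
    \sum_(s <- l) 2 ^- size s = 2^-1 :> R.
  by apply: ih => x y xy; apply: fn; exact: agree_ccons.
have [l0 l0P l0E] := h false; have [l1 l1P l1E] := h true.
exists (map (cons false) l0 ++ map (cons true) l1).
  move=> x xf; rewrite -(cconsK x).
  have xf' : half_space n (f \o ccons (x 0%N)) (fun i => x i.+1).
    by rewrite /half_space /= cconsK.
  case: (x 0%N) xf' => [/l1P|/l0P] [s sl xs];
    [exists (true :: s)|exists (false :: s)].
  - by rewrite mem_cat map_f ?orbT.
  - by case=> //= i; rewrite ltnS => /xs.
  - by rewrite mem_cat map_f.
  - by case=> //= i; rewrite ltnS => /xs.
rewrite big_cat !big_map /=.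
have e (l : seq (seq bool)) : \sum_(s <- l) 2 ^- (size s).+1 =
    2^-1 * (\sum_(s <- l) 2 ^- size s) :> R.
  by rewrite mulr_sumr; apply: eq_bigr => s _; rewrite exprS invfM.
by rewrite !e l0E l1E; lra.
Qed.

(** The outer measure asks for infinite sequences of words, so the list is padded with long words of
    total mass at most [e]. *)
Lemma cantor_lebesgue_le A (l : seq (seq bool)) :
  (forall x, A x -> exists2 s, s \in l & cylinder s x) ->
  (cantor_lebesgue R A <= (\sum_(s <- l) 2 ^- size s)%:E)%E.
Proof.
move=> Al; apply/lee_addgt0Pr => e e0.
have [m me] : exists m, 2 ^- m <= e :> R.
  exists (Num.bound e^-1); rewrite invf_ple ?posrE ?exprn_gt0 //.
  apply: le_trans (ltW (archi_boundP _)) _; first by rewrite invr_ge0 ltW.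
  by rewrite -natrX ler_nat ltnW // ltn_expl.
pose s k := if (k < size l)%N then nth [::] l k else nseq (m + k.+1) false.
pose a k : \bar R := (if (k < size l)%N then 2 ^- size (nth [::] l k) else 0)%:E.
apply: (@le_trans _ _ (\sum_(0 <= k <oo) (2 ^- size (s k))%:E)%E).
  apply: ereal_inf_lbound; exists s => // x /Al [t tl xt].
  exists (index t l) => //; rewrite /s index_mem tl nth_index //.
apply: (@le_trans _ _ (\sum_(0 <= k <oo) (a k + (e / (2 ^ k.+1)%:R)%:E))%E).
  apply: lee_nneseries => [k _ _|k _].
    by rewrite lee_fin invr_ge0 exprn_ge0.
  rewrite -EFinD lee_fin /s; case: ifPn => _.
    by rewrite lerDl divr_ge0 // ltW.
  rewrite add0r size_nseq exprD invfM natrX.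
  by apply: ler_wpM2r => //; rewrite invr_ge0 exprn_ge0.
have a0 k : (0 <= a k)%E.
  by rewrite lee_fin; case: ifP => // _; rewrite invr_ge0 exprn_ge0.
apply: le_trans (epsilon_trick _ a0 (ltW e0)) _.
rewrite leeD2r // (nneseries_split 0 (size l)) // add0n eseries0 ?adde0; last first.
  by move=> i li _; rewrite /a ltnNge li.
rewrite -sumEFin (big_nth [::]) !big_mkord le_eqVlt; apply/orP; left; apply/eqP.
by apply: eq_bigr => i _; rewrite /a ltn_ord.
Qed.

Lemma cantor_lebesgue_set0 : (cantor_lebesgue R set0 <= 0)%E.
Proof.
by have := @cantor_lebesgue_le set0 [::]; rewrite big_nil; apply => x.
Qed.

(** An explicit cover gives the upper bound. For the lower one, compactness makes any cover finite,
    and [mass] at a finite level bounds its sum. *)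
Lemma cantor_lebesgue_half_space n (f : cantor_space -> bool) :
  (forall x y, agree n x y -> f x = f y) ->
  clopen (half_space n f) /\ cantor_lebesgue R (half_space n f) = (2^-1)%:E.
Proof.
move=> fn; have half_clopen : clopen (half_space n f).
  apply: (@clopen_finitely_determined n.+1) => x y xy.
  by rewrite /half_space /= xy // (fn x y) //; exact: agreeW xy.
split=> //; apply/eqP; rewrite eq_le; apply/andP; split.
  by have [l lP <-] := half_space_cover fn; exact: cantor_lebesgue_le.
apply: le_ereal_inf_tmp => _ [s sP <-].
have [|N NP] := compact_cantor_countable_cover half_clopen.2 _ sP.
  by move=> i; exact: open_cylinder.
apply: (@le_trans _ _ (\sum_(0 <= k < N) (2 ^- size (s k))%:E)%E); last first.
  by apply: nneseries_lim_ge => k _ _; rewrite lee_fin invr_ge0 exprn_ge0.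
rewrite sumEFin lee_fin.
(* Deep enough for the bit [n] and for every word of the finite subcover. *)
pose M := maxn n.+1 (\max_(t <- map s (iota 0 N)) size t).
rewrite -(@mass_half_space n M f) // ?leq_maxl // /index_iota subn0.
rewrite -(big_map s xpredT (fun t => 2 ^- size t)).
apply: mass_le_cylinders => [t tl|x /NP [i /= iN xi]].
  by rewrite leq_max; apply/orP; right; exact: leq_bigmax_seq.
by exists (s i) => //; apply: map_f; rewrite mem_iota.
Qed.

End Mass.

(** * Separation of finitely many points by members of [Omega] *)

Lemma seq_uniform_bound (T : eqType) (l : seq T) (P : T -> nat -> Prop) :
  (forall t m n, (m <= n)%N -> P t m -> P t n) ->
  (forall t, t \in l -> exists n, P t n) ->
  exists n, forall t, t \in l -> P t n.
Proof.
move=> Pmono; elim: l => [|t l ih] lP; first by exists 0%N.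
have [n nP] := lP t (mem_head _ _).
have [|m mP] := ih; first by move=> u ul; apply: lP; rewrite inE ul orbT.
exists (maxn n m) => u; rewrite inE => /predU1P[->|/mP].
  exact: Pmono (leq_maxl _ _) nP.
exact: Pmono (leq_maxr _ _).
Qed.

Lemma finite_set_separated (F : set cantor_space) :
  finite_set F -> exists n, forall x y, F x -> F y -> agree n x y -> x = y.
Proof.
move=> /finite_seqP [l ->].
have [x m n mn xP y yl xy|x xl|n nP] := @seq_uniform_bound _ l
  (fun x n => forall y, y \in l -> agree n x y -> x = y).
- by apply: xP yl _; exact: agreeW xy.
- apply: (@seq_uniform_bound _ l (fun y n => agree n x y -> x = y)).
    by move=> y m n mn yP xy; apply: yP; exact: agreeW xy.
  move=> y yl; have [->|xy] := pselect (x = y); first by exists 0%N.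
  have [i xyi] : exists i, x i <> y i.
    apply: contrapT => xyN; apply: xy; apply/funext => i.
    by apply: contrapT => xyi; apply: xyN; exists i.
  by exists i.+1 => /(_ i (ltnSn i)).
- by exists n => x y xl yl; exact: nP.
Qed.

Section Solecki.
Variable R : realType.
Local Notation S := (solecki R).
Local Notation G := (solecki_gen R).

Lemma Omega_nonempty (A : Omega R) : exists x, sval A x.
Proof.
case: A => A [cA mA] /=; apply: contrapT => A0.
have A0E : A = set0 by apply/seteqP; split => // x Ax; apply: A0; exists x.
have := cantor_lebesgue_set0 R; rewrite -A0E mA lee_fin.
by rewrite leNgt invr_gt0 ltr0n.
Qed.

(* Take [n] such that [x] and the points of [Z] have distinct restrictions to
   [n].  The set prescribes the bit [n] as a function of the previous ones:
   different from [z n] after the restriction of [z] in [Z], and [x n] after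
   any other word. *)
Lemma Omega_separates x (Z : set cantor_space) : finite_set Z -> ~ Z x ->
  exists A : Omega R, sval A x /\ forall z, Z z -> ~ sval A z.
Proof.
move=> Zfin Zx.
have [|n nP] := @finite_set_separated (x |` Z).
  by rewrite finite_setU; split; first exact: finite_set1.
pose f y := if pselect (exists2 z, Z z & agree n z y) is left h
  then ~~ (projT1 (cid2 h)) n else x n.
have fn y y' : agree n y y' -> f y = f y'.
  move=> yy'; rewrite /f; case: pselect => [h|hN]; case: pselect => [h'|hN'] //.
  - case: (cid2 h) => z /= Zz zy; case: (cid2 h') => z' /= Zz' zy'.
    suff -> : z = z' by [].
    apply: nP; [by right|by right|] => i ni; rewrite zy // zy' //.
    exact: yy'.
  - by case: hN'; case: h => z Zz zy; exists z => // i ni; rewrite zy // yy'.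
  - by case: hN; case: h' => z Zz zy; exists z => // i ni; rewrite zy // yy'.
exists (exist _ (half_space n f) (cantor_lebesgue_half_space R fn)).
rewrite /half_space /=; split => [|z Zz]; rewrite /f; case: pselect => //.
- move=> [z Zz zx]; exfalso; apply: Zx.
  by rewrite -(nP z x _ _ zx) //; [right|left].
- move=> h; case: (cid2 h) => z' /= Zz' zz'.
  by rewrite (nP z' z _ _ zz'); [case: (z n)|right|right].
- by case; exists z.
Qed.

(* Points [y B <> x] of the members [B] of [L] are added to [Z], so that the
   set given by [Omega_separates] is none of the [B]. *)
Lemma Omega_separates_infinite x (Z : set cantor_space) (L : set (Omega R)) :
  finite_set Z -> ~ Z x -> finite_set L ->
  exists2 A : Omega R, ~ L A & sval A x /\ forall z, Z z -> ~ sval A z.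
Proof.
move=> Zfin Zx Lfin.
have /choice [y yP] (B : Omega R) : exists y, y <> x /\ (sval B x -> sval B y).
  (* If [B] misses [x], any other point serves; otherwise flip a bit of [x] beyond those that force
     membership in [B]. *)
  have [Bx|Bx] := pselect (sval B x); last first.
    exists (fun i => ~~ x i); split=> // /(congr1 (@^~ 0%N)).
    by case: (x _).
  have [n nP] := open_agree_sub (svalP B).1.1 Bx.
  exists (fun i => if i == n then ~~ x i else x i); split.
    by move=> /(congr1 (@^~ n)); rewrite eqxx; case: (x n).
  by move=> _; apply: nP => i; case: eqP => // ->; rewrite ltnn.
have [||A [Ax AZ]] := @Omega_separates x (Z `|` y @` L).
- by rewrite finite_setU; split=> //; exact: finite_image.
- by case=> // -[B LB yx]; case: (yP B).
exists A; last by split=> // z Zz; apply: AZ; left.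
move=> LA; apply: (AZ (y A)); first by right; exists A.
exact: (yP A).2.
Qed.

(** * Solecki's ideal and the two bounds *)

Lemma solecki_sub (A B : set (Omega R)) : A `<=` B -> S B -> S A.
Proof.
move=> AB [F Ff Bf]; exists F => //; apply: sub_finite_set Bf.
by move=> x [/AB].
Qed.

Lemma solecki0 : S set0.
Proof. by exists set0; rewrite ?set0D. Qed.

Lemma soleckiU (A B : set (Omega R)) : S A -> S B -> S (A `|` B).
Proof.
move=> [F Ff FA] [H Hf HB]; exists (F `|` H); first by rewrite finite_setU.
apply: (@sub_finite_set _ _ ((A `\` \bigcup_(x in F) G x) `|`
    (B `\` \bigcup_(x in H) G x))); last by rewrite finite_setU.
by move=> a [[Aa|Ba] aN]; [left|right]; split=> // -[x Fx xa]; apply: aN;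
  exists x => //; [left|right].
Qed.

Lemma solecki_bigcup n (A : nat -> set (Omega R)) :
  (forall i, S (A i)) -> S (\bigcup_(i < n) A i).
Proof.
move=> SA; elim: n => [|n ih].
  by apply: solecki_sub solecki0 => x [].
apply: solecki_sub (soleckiU ih (SA n)) => x [i /=].
by rewrite ltnS leq_eqVlt => /predU1P[->|ni] ?; [right|left; exists i].
Qed.

Lemma solecki_genS x : S (G x).
Proof.
exists [set x]; first exact: finite_set1.
by rewrite bigcup_set1 setDv; exact: finite_set0.
Qed.

(** The words padded with zeros are dense, and members of [Omega] are open and nonempty. *)
Lemma solecki_countable_cover :
  exists d : nat -> cantor_space, \bigcup_i G (d i) = setT.
Proof.
pose d i : cantor_space := nth false (odflt [::] (unpickle i)).
exists d; apply/seteqP; split => // A _.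
have [x Ax] := Omega_nonempty A.
have [n nP] := open_agree_sub (svalP A).1.1 Ax.
exists (pickle (mkseq x n)) => //; apply: nP => i ni.
by rewrite /d pickleK /= nth_mkseq.
Qed.

Lemma Phat_seqDU (A : nat -> set (Omega R)) :
  (forall i, S (A i)) -> Phat S (seqDU A).
Proof.
move=> SA; split; first exact: trivIset_seqDU.
by move=> n; apply: solecki_sub (SA n); exact: subset_seqDU.
Qed.

Lemma b_witness_uncountable E : b_witness S S S E -> ~ countable E.
Proof.
move=> [EP Ewit] /countable_injP [g ginj].
(* [e k] is the member of [E] with code [k], or constantly empty if [k] codes nothing. *)
have /choice [e eP] k : exists a : nat -> set (Omega R),
    (forall i, S (a i)) /\ forall a', E a' -> g a' = k -> a' = a.
  have [[a Ea ga]|aN] := pselect (exists2 a, E a & g a = k).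
    exists a; split=> [i|a' Ea' ga']; first by have [_] := EP a Ea.
    by apply: ginj; rewrite ?inE // ga.
  exists (fun=> set0); split=> [i|a' Ea' ga']; first exact: solecki0.
  by exfalso; apply: aN; exists a'.
have [d dT] := solecki_countable_cover.
pose B m := (\bigcup_(k < m.+2) \bigcup_(i < m.+2) e k i) `|`
  \bigcup_(j < m.+1) G (d j).
have SB m : S (B m).
  apply: soleckiU; last by apply: solecki_bigcup => j; exact: solecki_genS.
  by do 2 apply: solecki_bigcup => ?; exact: (eP _).1.
have BT : \bigcup_m B m = setT.
  apply/seteqP; split => // A _; have : setT A by [].
  by rewrite -dT => -[j _ Aj]; exists j => //; right; exists j => /=.
have [|a Ea] := Ewit (seqDU B).
  by split; [exact: Phat_seqDU|rewrite -seqDU_bigcup_eq].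
apply; have aE := (eP (g a)).2 a Ea erefl.
apply: (@solecki_sub _ (\bigcup_(i < (g a).+1) e (g a) i)); last first.
  by apply: solecki_bigcup => i; exact: (eP _).1.
move=> A [n _ [[_ BN] [i /= ilen Aai]]]; exists i => /=; last by rewrite -aE.
rewrite ltnNge; apply/negP => gi; apply: BN.
(* An index [i.+1] above [g a] puts the point in [B i], whose unions reach index [i.+1]; as [i < n],
   disjointification has removed it from term [n]. *)
case: i gi ilen Aai => // i gi ilen Aai; rewrite -bigcup_mkord.
exists i => //; left; exists (g a) => /=; first by rewrite ltnS ltnW.
by exists i.+1 => //=; rewrite -aE.
Qed.

(** The prefix 1^n 0 makes the pair readable from the point, so distinct [a] give disjoint injective
    sequences. *)
Definition spread (a : cantor_space) n : cantor_space :=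
  fun i => if (i < n)%N then true else if i == n then false else a (i - n.+1)%N.

Lemma spread_inj a b m n : spread a m = spread b n -> a = b /\ m = n.
Proof.
move=> ab; have mn : m = n.
  apply/eqP; rewrite eqn_leq; apply/andP; split; rewrite leqNgt; apply/negP => mn.
  - by have := congr1 (@^~ n) ab; rewrite /spread mn ltnn eqxx.
  - by have := congr1 (@^~ m) ab; rewrite /spread mn ltnn eqxx.
split=> //; subst n; apply/funext => i.
have := congr1 (@^~ (i + m.+1)%N) ab; rewrite /spread addnK.
by rewrite ltnNge addnS ltnW ?ltnS ?leq_addl //= gtn_eqF // ltnS leq_addl.
Qed.

Lemma aleph1_b_witness (kappa : set cantor_space) : ~ countable kappa ->
  b_witness S S S ((fun a => seqDU (fun n => G (spread a n))) @` kappa).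
Proof.
move=> kunc; split=> [_ [a _ <-]|A [[_ SA] AT]].
  by apply: Phat_seqDU => n; exact: solecki_genS.
have /choice [F FP] n : exists F, finite_set F /\
    finite_set (A n `\` \bigcup_(x in F) G x) by have [F] := SA n; exists F.
have [a ka aF] : exists2 a, kappa a & forall m n, ~ F n (spread a m).
  apply: contrapT => aN; apply: kunc.
  pose Y := \bigcup_n F n.
  have Yc : countable Y.
    by apply: bigcup_countable => // n _; apply: finite_set_countable; case: (FP n).
  (* [root] recovers [a] from [spread a m]; if every [a] in [kappa] had a term in the countable set
     [Y], then [kappa] would lie in the image of [Y]. *)
  pose root y := if pselect (exists a, exists m, y = spread a m) is left h
    then projT1 (cid h) else point.
  apply: sub_countable (sub_countable (card_image_le root _) Yc).
  apply: subset_card_le => a ka; apply: contrapT => aY; apply: aN; exists a => //.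
  move=> m n Fam; apply: aY; exists (spread a m); first by exists n.
  rewrite /root; case: pselect => [h|]; last by case; exists a, m.
  by case: cid => b /= [k] /spread_inj [].
exists (seqDU (fun n => G (spread a n))); first by exists a.
set W := (W in S W) => -[Z Zfin WZ].
have [k kZ] : exists k, ~ Z (spread a k).
  apply: contrapT => kN.
  suff /infiniteP : [set: nat] #<= Z by [].
  have [g] : $|{injfun [set: nat] >-> Z}|.
    apply/injfunPex; exists (spread a).
      by move=> k _; apply: contrapT => kZ; apply: kN; exists k.
    by move=> m n _ _ /spread_inj [].
  exact: inj_card_le g.
(* The finite set to avoid is what the covers leave out: of [W] by [Z], and of [A n] by [F n] for
   [n <= k]. *)
have [|||B BL [Bk BZ]] := @Omega_separates_infinite (spread a k)
    (Z `|` \bigcup_(n < k.+1) F n)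
    ((W `\` \bigcup_(x in Z) G x) `|`
      \bigcup_(n < k.+1) (A n `\` \bigcup_(x in F n) G x)).
- rewrite finite_setU; split=> //.
  by apply: bigcup_finite => [|n _]; [exact: finite_II|case: (FP n)].
- by case=> // -[n _]; exact: aF.
- rewrite finite_setU; split=> //.
  by apply: bigcup_finite => [|n _]; [exact: finite_II|case: (FP n)].
have [n _ ABn] : (\bigcup_n A n) B by rewrite AT.
have [nk|kn] := ltnP n k.+1.
  apply: BL; right; exists n => //; split=> // -[x Fx Bx].
  by apply: (BZ x) => //; right; exists n.
apply: BL; left; split; last by move=> [x Zx Bx]; apply: (BZ x) => //; left.
exists n => //; split=> //.
(* Disjointification keeps partial unions, so [B] lies in a term of index at most [k], hence below
   [n]. *)
have : (\bigcup_(i < k.+1) seqDU (fun n => G (spread a n)) i) B.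
  rewrite bigcup_mkord -bigsetU_seqDU -(bigcup_mkord _ (fun n => G (spread a n))).
  by exists k => /=.
move=> [i /= ik Bi]; exists i => //=; exact: leq_trans (ltnW kn).
Qed.

End Solecki.

Theorem theorem7p4 (R : realType) :
  exists (U : Type) (kappa : set U),
    is_aleph1 kappa /\ is_b (solecki R) (solecki R) (solecki R) kappa.
Proof.
have [kappa kaleph1] := exists_aleph1_subset cantor_space_uncountable.
exists cantor_space, kappa; split=> //; left.
have [kunc kmin] := (is_aleph1P kappa).1 kaleph1.
have Ewit := aleph1_b_witness R kunc; set E := (E in b_witness _ _ _ E) in Ewit.
(* The converse holds because [E], as a witness, is uncountable and [kappa] embeds into every
   uncountable set. *)
have Ek : E #<= kappa by exact: card_image_le.
exists E => //; split=> [|E' /b_witness_uncountable /kmin]; last exact: card_le_trans.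
by rewrite card_eq_le Ek kmin //; exact: b_witness_uncountable Ewit.
Qed.
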